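(* There is a countable set $A_0\subseteq 2^\omega$ such that for every $A$ with $A_0\subseteq A\subseteq 2^\omega$ and $2^\omega\setminus A$ dense, the quantifier $Q_A$ is not $\Sigma^1_1$-definable, i.e. the class $K_A$ of all $\tau_d$-structures $\mathcal M$ such that $\Omega(\mathcal M)\setminus A$ is dense is not the class of models of any $\Sigma^1_1$ sentence.
   Context: Let $\tau_d=\{R_0,R_1,R_2,R_3,R_4\}$ with $R_0,R_1,R_2$ binary and $R_3,R_4$ unary. For $n<\omega$ and $\eta\in 2^n$ let $\psi_\eta(x)$ be the first-order formula $R_4(x)\wedge\exists y_0\ldots\exists y_n\big(R_3(y_0)\wedge R_4(y_n)\wedge\bigwedge_{i<n}R_{\eta(i)}(y_i,y_{i+1})\wedge\bigwedge_{i\le n}R_2(y_i,x)\big)$. For a $\tau_d$-structure $\mathcal M$ and $a\in M$ let $\Omega(\mathcal M,a)=\{\eta\in 2^{<\omega}:\mathcal M\models\psi_\eta(a)\}$ and $\Omega(\mathcal M)=\{\eta\in 2^\omega:\exists a\in M\ \forall n<\omega\ \eta\restriction n\in\Omega(\mathcal M,a)\}$. A set $B\subseteq 2^\omega$ is dense if every $s\in 2^{<\omega}$ has an extension in $B$. $\Sigma^1_1$ sentences are those of the form $\exists R_1\ldots\exists R_m\varphi$ with $\varphi$ first-order. *)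

(* Defs.v *)
From mathcomp Require Import all_boot.
From mathcomp Require Import classical_sets cardinality.

Set Implicit Arguments.
Unset Strict Implicit.
Unset Printing Implicit Defensive.

Local Open Scope classical_set_scope.

Record vocabulary : Type := Vocabulary {
  symbol : Type;
  arity : symbol -> nat
}.

Record structure (tau : vocabulary) : Type := Structure {
  carrier :> Type;
  carrier_inhabited : inhabited carrier;
  interp : forall r : symbol tau, (arity r).-tuple carrier -> Prop
}.

(* First-order variables are named by natural numbers. *)
Inductive formula (tau : vocabulary) : Type :=
| Top
| Rel (r : symbol tau) (xs : (arity r).-tuple nat)
| Eq (x y : nat)
| Neg (phi : formula tau)
| And (phi psi : formula tau)
| Ex (x : nat) (phi : formula tau).

Arguments Top {tau}.
Arguments Rel {tau} r xs.
Arguments Eq {tau} x y.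

Fixpoint free_vars (tau : vocabulary) (phi : formula tau) : seq nat :=
  match phi with
  | Top => [::]
  | Rel r xs => xs
  | Eq x y => [:: x; y]
  | Neg phi => free_vars phi
  | And phi psi => free_vars phi ++ free_vars psi
  | Ex x phi => [seq y <- free_vars phi | y != x]
  end.

Definition update (T : Type) (v : nat -> T) (x : nat) (a : T) : nat -> T :=
  fun y => if y == x then a else v y.

Fixpoint sat (tau : vocabulary) (M : structure tau) (v : nat -> M)
    (phi : formula tau) : Prop :=
  match phi with
  | Top => True
  | Rel r xs => interp (map_tuple v xs)
  | Eq x y => v x = v y
  | Neg phi => ~ sat v phi
  | And phi psi => sat v phi /\ sat v psi
  | Ex x phi => exists a : M, sat (update v x a) phi
  end.

(* Meant for closed [phi], where the choice of assignment is immaterial since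
   carriers are inhabited. *)
Definition models (tau : vocabulary) (M : structure tau) (phi : formula tau) :
  Prop := forall v : nat -> M, sat v phi.

(* [tau] together with [m] new relation symbols of arities [ar]. *)
Definition expand_voc (tau : vocabulary) (m : nat) (ar : 'I_m -> nat) :
    vocabulary :=
  @Vocabulary (symbol tau + 'I_m)%type
    (fun r => match r with inl r => arity r | inr j => ar j end).

Definition expand (tau : vocabulary) (M : structure tau) (m : nat)
    (ar : 'I_m -> nat) (S : forall j : 'I_m, (ar j).-tuple M -> Prop) :
    structure (expand_voc tau ar) :=
  @Structure (expand_voc tau ar) M (carrier_inhabited M)
    (fun r => match r with inl r => @interp tau M r | inr j => @S j end).

Record sigma11_sentence (tau : vocabulary) : Type := Sigma11 {
  so_count : nat;
  so_arity : 'I_so_count -> nat;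
  so_matrix : formula (expand_voc tau so_arity);
  so_closed : free_vars so_matrix = [::]
}.

Definition sigma11_models (tau : vocabulary) (M : structure tau)
    (Phi : sigma11_sentence tau) : Prop :=
  exists S : forall j : 'I_(so_count Phi), (so_arity j).-tuple M -> Prop,
    models (expand S) (so_matrix Phi).

Definition sigma11_definable (tau : vocabulary) (K : structure tau -> Prop) :
    Prop :=
  exists Phi : sigma11_sentence tau,
    forall M : structure tau, K M <-> sigma11_models M Phi.

Inductive symbol_d : Type := R0 | R1 | R2 | R3 | R4.

Definition tau_d : vocabulary :=
  Vocabulary (fun r => match r with R0 | R1 | R2 => 2 | R3 | R4 => 1 end).

Definition Ands (tau : vocabulary) (phis : seq (formula tau)) : formula tau :=
  foldr (@And tau) Top phis.

Definition Exs (tau : vocabulary) (xs : seq nat) (phi : formula tau) :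
    formula tau := foldr (@Ex tau) phi xs.

(* The free variable x is variable 0, and y_i is variable i.+1.  An element of
   2^n is a sequence of n booleans, false and true standing for 0 and 1. *)
Definition psi (eta : seq bool) : formula tau_d :=
  let n := size eta in
  let x := 0 in
  let y i := i.+1 in
  let r3 z : formula tau_d := @Rel tau_d R3 [tuple z] in
  let r4 z : formula tau_d := @Rel tau_d R4 [tuple z] in
  let r2 z w : formula tau_d := @Rel tau_d R2 [tuple z; w] in
  let step (b : bool) z w : formula tau_d :=
    if b then @Rel tau_d R1 [tuple z; w] else @Rel tau_d R0 [tuple z; w] in
  And (r4 x)
    (Exs [seq y i | i <- iota 0 n.+1]
      (Ands [:: r3 (y 0);
                r4 (y n);
                Ands [seq step (nth false eta i) (y i) (y i.+1)
                     | i <- iota 0 n];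
                Ands [seq r2 (y i) x | i <- iota 0 n.+1]])).

(* Only the value of the assignment at the variable x of [psi eta] matters. *)
Definition Omega_at (M : structure tau_d) (a : M) : set (seq bool) :=
  [set eta | sat (fun _ => a) (psi eta)].

Definition restr (eta : nat -> bool) (n : nat) : seq bool := mkseq eta n.

Definition Omega (M : structure tau_d) : set (nat -> bool) :=
  [set eta | exists a : M, forall n : nat, Omega_at a (restr eta n)].

Definition dense_in_cantor (B : set (nat -> bool)) : Prop :=
  forall s : seq bool, exists2 eta, B eta & restr eta (size s) = s.

Definition K_ (A : set (nat -> bool)) (M : structure tau_d) : Prop :=
  dense_in_cantor (Omega M `\` A).

(* Main.v *)
Require Import Defs.
From mathcomp Require Import all_boot.
From mathcomp Require Import boolp classical_sets cardinality.

Local Open Scope classical_set_scope.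

(** There are only countably many Sigma^1_1 sentences.  Let [A0] collect, for
    each sentence having a model [N] with [Omega N] countable, the set [Omega N]
    of one such model.  If the complement of [A] is dense, it contains a
    countable dense set, which is [Omega M] for a disjoint union [M] of labelled
    rays; hence a sentence defining [K_ A] has a model with countable [Omega].
    The model [N] chosen for it satisfies [Omega N `<=` A0 `<=` A], so it is not
    in [K_ A]. *)

Fixpoint formula_code {tau : vocabulary} (code : symbol tau -> nat)
    (phi : formula tau) : GenTree.tree nat :=
  match phi with
  | Top => GenTree.Node 0 [::]
  | Rel r xs =>
      GenTree.Node 1 (GenTree.Leaf (code r) :: [seq GenTree.Leaf x | x <- xs])
  | Eq x y => GenTree.Node 2 [:: GenTree.Leaf x; GenTree.Leaf y]
  | Neg phi => GenTree.Node 3 [:: formula_code code phi]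
  | And phi psi => GenTree.Node 4 [:: formula_code code phi; formula_code code psi]
  | Ex x phi => GenTree.Node 5 [:: GenTree.Leaf x; formula_code code phi]
  end.

Lemma formula_code_inj {tau : vocabulary} {code : symbol tau -> nat} :
  injective code -> injective (formula_code code).
Proof.
move=> code_inj; have Leaf_inj : injective (@GenTree.Leaf nat) by move=> x y [].
elim=> [|r xs|x y|phi IH|phi IH psi IH'|x phi IH]
  [|r' xs'|x' y'|phi'|phi' psi'|x' phi'] //=.
(* The type of the argument tuple depends on the symbol, so the symbols are identified before the
   tuples are compared. *)
- case=> /code_inj err'; move: xs; rewrite err' => xs.
  by move/(inj_map Leaf_inj)/val_inj->.
- by case=> -> ->.
- by case=> /IH->.
- by case=> /IH-> /IH'->.
- by case=> -> /IH->.
Qed.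

Definition symbol_d_code (r : symbol_d) : nat :=
  match r with R0 => 0 | R1 => 1 | R2 => 2 | R3 => 3 | R4 => 4 end.

(** The shift by 5 clears the codes of the five symbols of [tau_d]. *)
Definition expand_code {m : nat} (ar : 'I_m -> nat)
    (r : symbol (expand_voc tau_d ar)) : nat :=
  match r with inl r => symbol_d_code r | inr j => j + 5 end.

Lemma expand_code_inj {m : nat} (ar : 'I_m -> nat) : injective (expand_code ar).
Proof.
move=> [r|j] [r'|j'] /=.
- by case: r; case: r'.
- by case: r; rewrite addnC.
- by case: r'; rewrite addnC.
- by move=> /addIn/val_inj->.
Qed.

Definition sigma11_code (Phi : sigma11_sentence tau_d) :
    nat * seq nat * GenTree.tree nat :=
  (so_count Phi, codom (@so_arity _ Phi),
   formula_code (expand_code _) (so_matrix Phi)).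

Lemma sigma11_code_inj : injective sigma11_code.
Proof.
case=> m ar phi cl [m' ar' phi' cl'] [] /= em.
subst m' => ear.
have {ear} ear : ar = ar'.
  apply/funext => j; have := congr1 (fun s => nth 0 s (enum_rank j)) ear.
  by rewrite !nth_codom enum_rankK.
subst ar' => /(formula_code_inj (expand_code_inj _)) ephi.
by subst phi'; congr Sigma11; apply: Prop_irrelevance.
Qed.

(* Destructing a satisfied conjunction directly would unfold [sat] in both
   conjuncts. *)
Lemma sat_And {tau : vocabulary} {M : structure tau} {v : nat -> M}
    {phi chi : formula tau} :
  sat v (And phi chi) <-> sat v phi /\ sat v chi.
Proof. by []. Qed.

Lemma sat_Ands_iota (tau : vocabulary) (M : structure tau) (v : nat -> M)
    (f : nat -> formula tau) (m n : nat) :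
  sat v (Ands [seq f i | i <- iota m n]) <->
  forall i, m <= i < m + n -> sat v (f i).
Proof.
elim: n m => [|n IH] m /=.
  by split=> // _ i; rewrite addn0 ltnNge; case: (m <= i).
split=> [[fm /IH fS] i /andP[]|H].
  rewrite leq_eqVlt => /predU1P[<- //|mi] lei.
  by apply: fS; rewrite mi addSnnS.
split; first by apply: H; rewrite leqnn addnS ltnS leq_addr.
by apply/IH => i /andP[mi lei]; apply: H; rewrite (ltnW mi) -addSnnS.
Qed.

Lemma sat_Exs_inv {tau : vocabulary} {M : structure tau} {v : nat -> M}
    {xs : seq nat} {phi : formula tau} :
  sat v (Exs xs phi) ->
  exists2 w : nat -> M, (forall z, z \notin xs -> w z = v z) & sat w phi.
Proof.
elim: xs v => [|x xs IH] v /=; first by exists v.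
case=> a /IH[w wE wphi]; exists w => // z.
by rewrite inE negb_or /update => /andP[/negPf zx /wE->]; rewrite /update zx.
Qed.

Lemma sat_Exs {tau : vocabulary} {M : structure tau} (w v : nat -> M)
    {xs : seq nat} {phi : formula tau} :
  (forall z, z \notin xs -> w z = v z) -> sat w phi -> sat v (Exs xs phi).
Proof.
elim: xs v => [|x xs IH] v wE wphi /=.
  by have <- : w = v by apply/funext => z; apply: wE.
exists (w x); apply: IH => // z zxs; rewrite /update.
by case: eqP => [->//|/eqP zx]; apply: wE; rewrite inE negb_or zx.
Qed.

(* The point [(s, i)] is the [i]-th vertex of the ray labelled by [e s].  Every
   vertex may serve as the variable x of [psi] for its own ray. *)
Definition rays_interp (e : seq bool -> nat -> bool) (r : symbol_d)
    (ps : seq (seq bool * nat)) : Prop :=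
  let edge (b : bool) (p q : seq bool * nat) :=
    [/\ q.1 = p.1, q.2 = p.2.+1 & e p.1 p.2 = b] in
  match r, ps with
  | R0, [:: p; q] => edge false p q
  | R1, [:: p; q] => edge true p q
  | R2, [:: p; q] => p.1 = q.1
  | R3, [:: p] => p.2 = 0
  | R4, _ => True
  | _, _ => False
  end.

Definition rays (e : seq bool -> nat -> bool) : structure tau_d :=
  @Structure tau_d (seq bool * nat)%type (inhabits ([::], 0))
    (fun r ps => rays_interp e r ps).

(** [R2] keeps every y_i on the ray of [a], [R3] puts y_0 at its origin, and the edges then force
    y_i to be vertex i, whose outgoing edge carries bit i of the label. *)
Lemma Omega_at_rays {e : seq bool -> nat -> bool} (a : rays e) (eta : seq bool) :
  Omega_at a eta <-> eta = restr (e a.1) (size eta).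
Proof.
split.
- rewrite /Omega_at /mkset /psi => /sat_And[_].
  move=> /sat_Exs_inv[w wE] /sat_And[w1 /sat_And[_ /sat_And[]]].
  move=> /sat_Ands_iota steps /sat_And[/sat_Ands_iota in_ray _].
  have w0 : w 0 = a by apply: wE; apply/negP => /mapP[i].
  have y1 i : i <= size eta -> (w i.+1).1 = a.1.
    by move=> lei; rewrite (in_ray i) //= w0.
  (* The base case is [w1], the [R3] conjunct at y_0. *)
  have y2 i : i <= size eta -> (w i.+1).2 = i.
    elim: i => // i IH lti; have := steps i lti.
    by case: nth => -[_ -> _]; rewrite IH // ltnW.
  apply: (@eq_from_nth _ false); first by rewrite size_mkseq.
  move=> i lti; rewrite nth_mkseq //; have := steps i lti.
  by case: nth => -[_ _]; rewrite y1 ?y2 // ltnW.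
- move=> etaE; split=> //.
  (* Variable [i.+1] stands for y_i and goes to vertex [i], hence [z.-1]; all unquantified variables
     keep the value [a]. *)
  apply: (@sat_Exs _ (rays e)
    (fun z => if 0 < z <= (size eta).+1 then (a.1, z.-1) else a)).
    move=> [|z] //; case: ifP => // lez /negP[].
    by apply: (map_f S); rewrite mem_iota.
  split=> //; split=> //; split.
    apply/sat_Ands_iota => i /= lti.
    have -> : nth false eta i = e a.1 i by rewrite etaE nth_mkseq.
    by case eai: (e a.1 i); rewrite /= !ltnS lti (ltnW lti).
  split=> //.
  apply/(@sat_Ands_iota _ (rays e) _ _ 0 (size eta).+1) => i /= lti.
  by rewrite lti.
Qed.

Lemma Omega_rays (e : seq bool -> nat -> bool) : Omega (rays e) = range e.
Proof.
apply/seteqP; split=> eta.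
- case=> a H; exists a.1 => //; apply/funext => i.
  have /Omega_at_rays := H i.+1; rewrite size_mkseq.
  by move/(congr1 (fun s => nth false s i)); rewrite !nth_mkseq.
- case=> s _ <-; exists (s, 0) => n; apply/Omega_at_rays.
  by rewrite size_mkseq.
Qed.

Lemma sigma11_countable_Omega_hitting :
  exists2 A0 : set (nat -> bool), countable A0 &
    forall (Phi : sigma11_sentence tau_d) (M : structure tau_d),
      sigma11_models M Phi -> countable (Omega M) ->
      exists2 N, sigma11_models N Phi & Omega N `<=` A0.
Proof.
pose has_model c (B : set (nat -> bool)) :=
  exists Phi N, [/\ sigma11_code Phi = c, sigma11_models N Phi & Omega N = B].
have /choice[F FP] c : exists B, countable B /\
    ((exists2 B', countable B' & has_model c B') -> has_model c B).
  have [[B cB BP]|no] := pselect (exists2 B', countable B' & has_model c B').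
    by exists B.
  (* The default [set0] keeps [F c] countable for every code. *)
  by exists set0; split=> [|/no//]; apply: countable0.
exists (\bigcup_c F c).
  by apply: bigcup_countable => [|c _]; [apply: countableP | case: (FP c)].
move=> Phi M MPhi cM; have [_] := FP (sigma11_code Phi).
case; first by exists (Omega M) => //; exists Phi, M.
(* The choice was made per code, so injectivity is needed to identify [Psi] with [Phi]. *)
move=> Psi [N [/sigma11_code_inj -> NPhi NE]].
by exists N => // eta; rewrite NE => ?; exists (sigma11_code Phi).
Qed.

Theorem theorem15 :
  exists A0 : set (nat -> bool), countable A0 /\
    forall A : set (nat -> bool),
      A0 `<=` A -> dense_in_cantor (~` A) -> ~ sigma11_definable (K_ A).
Proof.
have [A0 cA0 A0P] := sigma11_countable_Omega_hitting.
exists A0; split=> // A A0A denseC [Phi PhiP].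
(* One label outside [A] through each finite sequence: countably many labels, still dense. *)
have /choice[e eP] s : exists eta, ~ A eta /\ restr eta (size s) = s.
  by have [eta] := denseC s; exists eta.
have KM : K_ A (rays e).
  move=> s; rewrite Omega_rays; have [eA es] := eP s.
  by exists (e s).
have cM : countable (Omega (rays e)).
  rewrite Omega_rays.
  exact: card_le_trans (card_image_le _ _) (countableP _).
have [N /PhiP KN NA0] := A0P _ _ (proj1 (PhiP _) KM) cM.
(* Density at the empty sequence already gives a point of [Omega N] outside [A]. *)
by have [eta [/NA0/A0A]] := KN [::].
Qed.
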